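(* Let $\mathcal{H}$ be a real Hilbert space, let $\mathcal{A}:\mathcal{H}\to2^{\mathcal{H}}$ be an operator and let $\mathcal{M}$ be an admissible preconditioner for $\mathcal{A}$ with closed range. Let $\mathcal{M}=\mathcal{C}\mathcal{C}^*$, where $\mathcal{D}$ is a real Hilbert space and $\mathcal{C}:\mathcal{D}\to\mathcal{H}$ is a bounded linear injective operator with $\mathcal{C}^*$ onto. Let $\alpha>0$. Then $\mathcal{M}^{-1}\mathcal{A}$ is $\mathcal{M}$-$\alpha$-strongly monotone if and only if $\mathcal{C}^*\rhd\mathcal{A}$ is $\alpha$-strongly monotone. In that case, $\widetilde{\mathcal{T}}:=(I+\mathcal{C}^*\rhd\mathcal{A})^{-1}$ is a contraction of factor $1/(1+\alpha)$.
   Context: A (possibly multivalued) operator is identified with its graph; inverses are inverses of multivalued operators (relations). An admissible preconditioner for $\mathcal{A}$ is a linear, bounded, self-adjoint, positive semi-definite operator $\mathcal{M}:\mathcal{H}\to\mathcal{H}$ such that $(\mathcal{M}+\mathcal{A})^{-1}\mathcal{M}$ is single-valued and has full domain. $\mathcal{M}^{-1}\mathcal{A}$ is the multivalued operator with graph $\{(u,z):\mathcal{M}z\in\mathcal{A}u\}$. Put $\langle u,v\rangle_{\mathcal{M}}:=\langle\mathcal{M}u,v\rangle$ and $\|u\|_{\mathcal{M}}:=\sqrt{\langle u,u\rangle_{\mathcal{M}}}$. An operator $\mathcal{B}$ on $\mathcal{H}$ is $\mathcal{M}$-$\alpha$-strongly monotone if $\langle v-v',u-u'\rangle_{\mathcal{M}}\ge\alpha\|u-u'\|_{\mathcal{M}}^2$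 for all $(u,v),(u',v')\in\mathcal{B}$. An operator $\mathcal{B}$ on $\mathcal{D}$ is $\alpha$-strongly monotone if $\langle v-v',u-u'\rangle\ge\alpha\|u-u'\|^2$ for all $(u,v),(u',v')\in\mathcal{B}$. The parallel composition is the multivalued operator on $\mathcal{D}$ given by $\mathcal{C}^*\rhd\mathcal{A}:=(\mathcal{C}^*\mathcal{A}^{-1}\mathcal{C})^{-1}$. A contraction of factor $r$ is an $r$-Lipschitz (single-valued) map $\mathcal{D}\to\mathcal{D}$. *)

(* Defs.v *)
From HB Require Import structures.
From mathcomp Require Import all_boot all_order all_algebra.
From mathcomp Require Import all_classical all_reals all_analysis.
From mathcomp Require Import ring lra.

Set Implicit Arguments.
Unset Strict Implicit.
Unset Printing Implicit Defensive.
Import Order.TTheory GRing.Theory Num.Theory numFieldNormedType.Exports.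
Local Open Scope classical_set_scope.
Local Open Scope ring_scope.

(* A real Hilbert space: a complete normed module whose norm is induced by an
   inner product. *)
HB.mixin Record NormedModule_isHilbert (R : realType) H
    & CompleteNormedModule R H := {
  inner : {dot H for idfun};
  inner_norm : forall x : H, inner x x = `|x| ^+ 2
}.

#[short(type="hilbertType")]
HB.structure Definition Hilbert (R : realType) :=
  {H of NormedModule_isHilbert R H & CompleteNormedModule R H}.

Notation "''[' u , v ]" := (inner u%R v%R) : ring_scope.

Section InnerTheory.
Variables (R : realType) (H : hilbertType R).
Implicit Types (u v w : H) (a : R).

Lemma innerC u v : '[u, v] = '[v, u].
Proof. by have := hermC (@inner R H) u v; rewrite expr0 mul1r. Qed.

Lemma innerDl u v w : '[u + v, w] = '[u, w] + '[v, w].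
Proof. by rewrite linearDl. Qed.

Lemma innerZl a u v : '[a *: u, v] = a * '[u, v].
Proof. by rewrite linearZl_LR. Qed.

Lemma innerDr u v w : '[u, v + w] = '[u, v] + '[u, w].
Proof. by rewrite innerC innerDl !(innerC u). Qed.

Lemma innerZr a u v : '[u, a *: v] = a * '[u, v].
Proof. by rewrite innerC innerZl innerC. Qed.

Lemma innerNl u v : '[- u, v] = - '[u, v].
Proof. by rewrite -scaleN1r innerZl mulN1r. Qed.

Lemma innerNr u v : '[u, - v] = - '[u, v].
Proof. by rewrite -scaleN1r innerZr mulN1r. Qed.

Lemma cauchy_schwarz u v : `|'[u, v]| <= `|u| * `|v|.
Proof.
have [->|v0] := eqVneq v 0.
  by rewrite -(scale0r 0) innerZr scale0r normr0 mul0r normr0 mulr0.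
have nv : 0 < `|v| ^+ 2 by rewrite exprn_gt0 ?normr_gt0.
rewrite -(@ler_pXn2r _ 2) ?nnegrE ?mulr_ge0// exprMn -normrX ger0_norm ?sqr_ge0//.
have := sqr_ge0 `|(`|v| ^+ 2) *: u - '[u, v] *: v|.
rewrite -inner_norm innerDl !innerDr !innerNl !innerNr !innerZl !innerZr.
rewrite (innerC v u) !inner_norm => h.
rewrite -(ler_pM2l nv); set a := `|u| in h *; set b := `|v| in h *; nra.
Qed.

Lemma innerI v w : (forall u, '[u, v] = '[u, w]) -> v = w.
Proof.
move=> vw; apply/eqP; rewrite -subr_eq0 -normr_eq0 -sqrf_eq0 -inner_norm.
by rewrite innerDr innerNr vw subrr.
Qed.

End InnerTheory.

Definition bounded_op (R : realType) (D H : hilbertType R) (f : D -> H) :=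
  exists k : R, forall x, `|f x| <= k * `|x|.

(* [get] selects the unique [y] representing the functional [<f _, x>]; that it
   exists for bounded linear [f] is [adjointP]. *)
Definition adjoint (R : realType) (D H : hilbertType R) (f : D -> H) : H -> D :=
  fun x => get [set y | forall d, '[f d, x] = '[d, y]].

Definition self_adjoint (R : realType) (H : hilbertType R) (M : H -> H) :=
  forall u v, '[M u, v] = '[u, M v].

Definition positive_semidefinite (R : realType) (H : hilbertType R)
  (M : H -> H) := forall u, 0 <= '[M u, u].

Section Riesz.
Variables (R : realType) (D : hilbertType R) (g : D -> R) (k : R).
Hypothesis gD : forall u v, g (u + v) = g u + g v.
Hypothesis gZ : forall a u, g (a *: u) = a * g u.
Hypothesis gk : forall u, `|g u| <= k * `|u|.

Let J (d : D) := '[d, d] - 2 * g d.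

Let J_ge d : - k ^+ 2 <= J d.
Proof.
rewrite /J inner_norm; have := gk d; have := ler_norm (g d).
have := sqr_ge0 (`|d| - k); set n := `|d|; nra.
Qed.

Let J_lb : has_inf (range J).
Proof.
by split; [exists (J 0), 0 | exists (- k ^+ 2) => _ [d _ <-]; exact: J_ge].
Qed.

Let m := inf (range J).

Let m_le d : m <= J d.
Proof. by apply: ge_inf; [exact: J_lb.2 | exists d]. Qed.

Let parallelogram a b :
  `|a - b| ^+ 2 = 2 * J a + 2 * J b - 4 * J (2^-1 *: (a + b)).
Proof.
rewrite -inner_norm /J gZ gD innerZl innerZr !innerDl !innerDr !innerNl !innerNr.
rewrite (innerC b a); by field.
Qed.

Let minimizing : exists d : nat -> D, forall n, J (d n) < m + n.+1%:R^-1.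
Proof.
have ex n : exists d, J d < m + n.+1%:R^-1.
  have e0 : 0 < n.+1%:R^-1 :> R by [].
  by have [_ [d _ <-] dm] := inf_adherent e0 J_lb; exists d.
by have [d dm] := choice ex; exists d.
Qed.

Let g_continuous (d : nat -> D) y : d @ \oo --> y -> g \o d @ \oo --> g y.
Proof.
move=> dy; apply/cvgrPdist_le => e e0.
have k1 : 0 < `|k| + 1 by rewrite ltr_wpDl.
have : \forall n \near \oo, `|y - d n| <= e / (`|k| + 1).
  by apply: cvgr_dist_le => //; rewrite divr_gt0.
apply: filterS => n; rewrite ler_pdivlMr// => yn.
have -> : g y - g (d n) = g (y - d n) by rewrite gD -(scaleN1r (d n)) gZ mulN1r.
apply: le_trans (gk _) _; apply: le_trans yn; rewrite mulrC ler_wpM2l//.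
by rewrite (le_trans (ler_norm _))// lerDl.
Qed.

Let minimizer : exists y, J y <= m.
Proof.
have [d dm] := minimizing.
have inv0 := @cvg_harmonic R.
have d_cvg : cvgn d.
  apply/cauchy_cvgP; apply/cauchy_ballP => _/posnumP[e]; near_simpl.
  have e4 : 0 < e%:num ^+ 2 / 4 by rewrite divr_gt0.
  have H1 : \forall n \near \oo, n.+1%:R^-1 < e%:num ^+ 2 / 4 :> R.
    move/cvgrPdist_lt: inv0 => /(_ _ e4); apply: filterS => n.
    by rewrite /= sub0r normrN ger0_norm.
  exists ([set n | n.+1%:R^-1 < e%:num ^+ 2 / 4 :> R],
          [set n | n.+1%:R^-1 < e%:num ^+ 2 / 4 :> R]) => //= -[a b] /= [la lb].
  rewrite -ball_normE /= -(@ltr_pXn2r _ 2) ?nnegrE// parallelogram.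
  have := dm a; have := dm b; have := m_le (2^-1 *: (d a + d b)).
  move: la lb; set ia := a.+1%:R^-1; set ib := b.+1%:R^-1.
  set e2 := e%:num ^+ 2; set Jc := J (2^-1 *: _); set Ja := J (d a); set Jb := J (d b).
  by move: ia ib e2 Jc Ja Jb m => ia ib e2 Jc Ja Jb m'; lra.
exists (limn d).
have Jd : J \o d @ \oo --> J (limn d).
  rewrite /J; under eq_fun do rewrite inner_norm.
  rewrite inner_norm; apply: cvgB.
    by rewrite !expr2; apply: cvgM; apply: cvg_norm.
  by apply: cvgMl_tmp; exact: g_continuous.
have md : (fun n => m + n.+1%:R^-1) @ \oo --> m.
  by rewrite -[X in _ --> X]addr0; apply: cvgD => //; exact: cvg_cst.
by apply: ler_cvg_to Jd md _; apply: nearW => n /=; exact/ltW/dm.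
Qed.

Lemma riesz : exists y, forall d, g d = '[d, y].
Proof.
have [y Jy] := minimizer; exists y => d.
set c := '[d, y] - g d; set n := '[d, d].
have n0 : 0 <= n by rewrite /n inner_norm sqr_ge0.
have var t : 0 <= 2 * t * c + t ^+ 2 * n.
  have := le_trans Jy (m_le (y + t *: d)).
  rewrite /J gD gZ !innerDl !innerDr !innerZl !innerZr (innerC y d) /c /n; lra.
suff : c = 0 by rewrite /c; lra.
have := var (- c / (n + 1)); have n1 : 0 < n + 1 by rewrite ltr_wpDl.
have -> : 2 * (- c / (n + 1)) * c + (- c / (n + 1)) ^+ 2 * n =
          - (c ^+ 2 * ((n + 2) / (n + 1) ^+ 2)) by field; rewrite gt_eqF.
rewrite oppr_ge0 pmulr_lle0; last by rewrite divr_gt0 ?exprn_gt0// ltr_wpDl.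
by move=> c0; apply/eqP; rewrite -sqrf_eq0 eq_le c0 sqr_ge0.
Qed.

End Riesz.

Lemma adjointP (R : realType) (D H : hilbertType R) (f : {linear D -> H}) :
  bounded_op f -> forall d x, '[f d, x] = '[d, adjoint f x].
Proof.
move=> [k fk] d x; rewrite /adjoint.
suff /getPex /(_ d) : exists y, forall d, '[f d, x] = '[d, y] by [].
apply: (@riesz _ _ (fun d => '[f d, x]) (`|x| * k)).
- by move=> u v; rewrite linearD innerDl.
- by move=> a u; rewrite linearZ innerZl.
- move=> u; rewrite (le_trans (cauchy_schwarz _ _))// mulrC -mulrA.
  by rewrite ler_wpM2l.
Qed.

(* A multivalued operator from [X] to [Y] is its graph, a [set (X * Y)]; the
   composition [B \; A] (first [A], then [B]) and the inverse [A^-1] are those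
   of [relation_scope]. *)
Definition graph (X Y : Type) (f : X -> Y) : set (X * Y) :=
  [set xy | xy.2 = f xy.1].

Section Operators.
Variables (R : realType).
Implicit Types (H D : hilbertType R).
Local Open Scope relation_scope.

Definition op_add H (A B : set (H * H)) : set (H * H) :=
  [set xz | exists y1 y2, [/\ A (xz.1, y1), B (xz.1, y2) & xz.2 = (y1 + y2)%R]].

Definition single_valued_full_domain H (A : set (H * H)) :=
  is_totalfun (fun x y => A (x, y)).

Definition admissible H (A : set (H * H)) (M : {linear H -> H}) :=
  [/\ bounded_op M, self_adjoint M, positive_semidefinite M &
      single_valued_full_domain ((op_add (graph M) A)^-1 \; graph M)].

Definition precond H (M : H -> H) (A : set (H * H)) : set (H * H) :=
  [set uz | A (uz.1, M uz.2)].

Definition inner_M H (M : H -> H) (u v : H) : R := '[M u, v].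

Definition norm_M H (M : H -> H) (u : H) : R := Num.sqrt (inner_M M u u).

Definition M_strongly_monotone H (M : H -> H) (alpha : R) (B : set (H * H)) :=
  forall u v u' v', B (u, v) -> B (u', v') ->
    alpha * norm_M M (u - u') ^+ 2 <= inner_M M (v - v') (u - u').

Definition strongly_monotone H (alpha : R) (B : set (H * H)) :=
  forall u v u' v', B (u, v) -> B (u', v') ->
    alpha * `|u - u'| ^+ 2 <= '[v - v', u - u'].

(* [parallel_comp C A] is the parallel composition of [A] by the adjoint of
   [C]. *)
Definition parallel_comp D H (C : D -> H) (A : set (H * H)) : set (D * D) :=
  (graph (adjoint C) \; A^-1 \; graph C)^-1.

Definition resolvent H (B : set (H * H)) : set (H * H) :=
  (op_add (graph id) B)^-1.

Definition contraction_op H (r : R) (B : set (H * H)) :=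
  exists2 f : H -> H, B = graph f & r.-lipschitz f.

End Operators.

(* Main.v *)
Require Import Defs.
From mathcomp Require Import all_boot all_order all_algebra.
From mathcomp Require Import all_classical all_reals all_analysis.
From mathcomp Require Import lra.
Import Order.TTheory GRing.Theory Num.Theory numFieldNormedType.Exports.
Local Open Scope classical_set_scope.
Local Open Scope ring_scope.

(** Write [C*] for the adjoint of [C].  The factorization [M = C C*] makes [C*]
    an isometry from the [M]-seminorm to the norm of [D]:
    [<M x, y> = <C* x, C* y>].  It also transports the graphs: if [M v] lies in
    [A u], that is [C (C* v)] lies in [A u], then by definition of the parallel
    composition [C* v] lies in [(C* |> A) (C* u)]; and as [C*] is onto, every
    pair in the graph of [C* |> A] arises in this way.  So the two strong
    monotonicity inequalities are literally the same family of inequalities.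

    For the resolvent, strong monotonicity and Cauchy-Schwarz show that any two
    pairs [(d, x)], [(d', x')] of its graph satisfy
    [(1 + alpha) |x - x'| <= |d - d'|], which gives both single-valuedness and
    the Lipschitz bound.  Only full domain remains, and this is where
    admissibility enters: given [d = C* w], a point [y] of
    [(M + A)^-1 M w] satisfies [M w - M y = C (d - C* y)] in [A y], so that
    [C* y] is a value of the resolvent at [d]. *)

Lemma adjointB {R : realType} {D H : hilbertType R} {f : {linear D -> H}} :
  bounded_op f -> {morph adjoint f : x y / x - y}.
Proof.
move=> f_bounded x y; apply: innerI => d.
by rewrite -adjointP // !innerDr !innerNr !adjointP.
Qed.

(** In the pairing [<M x, y>], a factorization of [M] moves [C] to the other
    side: [C*] is an isometry for the [M]-seminorm. *)
Lemma inner_M_factor {R : realType} {D H : hilbertType R}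
    {C : {linear D -> H}} {M : H -> H} :
  bounded_op C -> M = C \o adjoint C ->
  forall x y, inner_M M x y = '[adjoint C x, adjoint C y].
Proof. by move=> C_bounded -> x y; rewrite /inner_M /= adjointP. Qed.

Lemma norm_M_factor {R : realType} {D H : hilbertType R}
    {C : {linear D -> H}} {M : H -> H} :
  bounded_op C -> M = C \o adjoint C ->
  forall x, norm_M M x = `|adjoint C x|.
Proof.
move=> C_bounded MC x; rewrite /norm_M (inner_M_factor C_bounded MC).
by rewrite inner_norm sqrtr_sqr normr_id.
Qed.

Lemma parallel_compP {R : realType} {D H : hilbertType R} (C : D -> H)
    (A : set (H * H)) (d e : D) :
  parallel_comp C A (d, e) <-> exists2 h, A (h, C e) & d = adjoint C h.
Proof.
rewrite /parallel_comp /graph /=.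
split=> [[h [_ -> AhCe] dh]|[h AhCe dh]]; first by exists h.
by exists h => //; exists (C e).
Qed.

Lemma resolventP {R : realType} {H : hilbertType R} (B : set (H * H))
    (d x : H) :
  resolvent B (d, x) <-> B (x, d - x).
Proof.
rewrite /resolvent /op_add /graph /=.
split=> [[_ [z [-> Bxz ->]]]|Bxz]; first by rewrite addrC addKr.
by exists x, (d - x); split=> //=; rewrite addrC subrK.
Qed.

(** Adding [|x - x'|^2] to both sides of the strong monotonicity inequality
    turns its right-hand side into [<d - d', x - x'>], to which Cauchy-Schwarz
    applies. *)
Lemma resolvent_dist {R : realType} {H : hilbertType R} {alpha : R}
    {B : set (H * H)} {d d' x x' : H} :
  0 < alpha -> strongly_monotone alpha B ->
  resolvent B (d, x) -> resolvent B (d', x') ->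
  (1 + alpha) * `|x - x'| <= `|d - d'|.
Proof.
move=> alpha_gt0 monoB /resolventP Bx /resolventP Bx'.
have := monoB _ _ _ _ Bx Bx'.
have -> : d - x - (d' - x') = d - d' - (x - x').
  by rewrite !opprD !opprK addrACA.
rewrite innerDl innerNl inner_norm => mono.
have cs := le_trans (ler_norm _) (cauchy_schwarz (d - d') (x - x')).
have [->|xx'] := eqVneq (x - x') 0; first by rewrite normr0 mulr0.
have n_gt0 : 0 < `|x - x'| by rewrite normr_gt0.
rewrite -(ler_pM2r n_gt0); move: mono cs; rewrite expr2; lra.
Qed.

Lemma resolvent_contraction {R : realType} {H : hilbertType R} (alpha : R)
    (B : set (H * H)) :
  0 < alpha -> strongly_monotone alpha B ->
  (forall d, exists x, resolvent B (d, x)) ->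
  contraction_op (1 / (1 + alpha)) (resolvent B).
Proof.
move=> alpha_gt0 monoB /choice[f Bf].
have a1_gt0 : 0 < 1 + alpha by rewrite addr_gt0.
exists f.
  apply/seteqP; split=> -[d x]; last by rewrite /graph /= => ->.
  move=> Bdx; apply/eqP; rewrite /= -subr_eq0 -normr_le0 -(pmulr_rle0 _ a1_gt0).
  by have := resolvent_dist alpha_gt0 monoB Bdx (Bf d); rewrite subrr normr0.
move=> [d d'] _ /=; rewrite mul1r mulrC ler_pdivlMr // mulrC.
exact: (resolvent_dist alpha_gt0 monoB (Bf d) (Bf d')).
Qed.

(** Because [C*] is onto, a graph point [(d, e)] of [C* |> A] with
    [d = C* h] and [C e] in [A h] can be written with [e = C* v], and then
    [C e = M v]. *)
Lemma parallel_comp_precond {R : realType} {D H : hilbertType R}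
    {C : D -> H} {M : H -> H} (A : set (H * H)) :
  range (adjoint C) = [set: D] -> M = C \o adjoint C ->
  parallel_comp C A =
  [set (adjoint C uv.1, adjoint C uv.2) | uv in precond M A].
Proof.
move=> Cadj_onto MC; apply/seteqP; split=> [[d e]|_ [[u v] Auv <-]].
  move=> /parallel_compP[u Aue ->].
  have [v _ ve] : range (adjoint C) e by rewrite Cadj_onto.
  by exists (u, v); rewrite /precond /= ?MC /= ve.
by apply/parallel_compP; exists u => //; move: Auv; rewrite /precond /= MC.
Qed.

Lemma strongly_monotone_parallel_comp {R : realType} {D H : hilbertType R}
    (A : set (H * H)) {M : H -> H} {C : {linear D -> H}} (alpha : R) :
  bounded_op C -> range (adjoint C) = [set: D] -> M = C \o adjoint C ->
  M_strongly_monotone M alpha (precond M A) <->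
  strongly_monotone alpha (parallel_comp C A).
Proof.
move=> C_bounded Cadj_onto MC.
have normE := norm_M_factor C_bounded MC.
have innerE := inner_M_factor C_bounded MC.
rewrite (parallel_comp_precond A Cadj_onto MC).
split=> [mono _ _ _ _ [[u v] Auv [<- <-]] [[u' v'] Auv' [<- <-]]|].
  by have := mono _ _ _ _ Auv Auv'; rewrite normE innerE !adjointB.
move=> mono u v u' v' Auv Auv'; rewrite normE innerE !adjointB //.
by apply: mono; [exists (u, v) | exists (u', v')].
Qed.

Lemma resolvent_parallel_comp_total {R : realType} {D H : hilbertType R}
    {A : set (H * H)} {M : {linear H -> H}} {C : {linear D -> H}} :
  admissible A M -> bounded_op C -> range (adjoint C) = [set: D] ->
  (M : H -> H) = C \o adjoint C ->
  forall d, exists x, resolvent (parallel_comp C A) (d, x).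
Proof.
move=> [_ _ _]; rewrite /single_valued_full_domain /op_add /graph /= => total.
move=> C_bounded Cadj_onto MC d.
have [w _ <-] : range (adjoint C) d by rewrite Cadj_onto.
have [[y /= [_ -> [_ [z [-> Ayz Mwyz]]]]] _] := total w.
exists (adjoint C y); apply/resolventP/parallel_compP; exists y => //.
rewrite linearB.
have -> : C (adjoint C w) - C (adjoint C y) = z; last exact: Ayz.
by move: Mwyz; rewrite /= MC /= => ->; rewrite addrC addKr.
Qed.

Theorem theorem2p19 (R : realType) (H D : hilbertType R)
    (A : set (H * H)) (M : {linear H -> H}) (C : {linear D -> H}) (alpha : R)
    (M_admissible : admissible A M)
    (M_closed_range : closed (range M))
    (C_bounded : bounded_op C)
    (C_injective : injective C)
    (Cadj_onto : range (adjoint C) = [set: D])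
    (M_factor : (M : H -> H) = C \o adjoint C)
    (alpha_gt0 : 0 < alpha) :
  (M_strongly_monotone M alpha (precond M A) <->
   strongly_monotone alpha (parallel_comp C A)) /\
  (strongly_monotone alpha (parallel_comp C A) ->
   contraction_op (1 / (1 + alpha)) (resolvent (parallel_comp C A))).
Proof.
split; first exact: strongly_monotone_parallel_comp.
move=> mono; apply: resolvent_contraction => //.
exact: resolvent_parallel_comp_total M_admissible C_bounded Cadj_onto M_factor.
Qed.
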